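(* Let $(X;* )$ be an entropic magma. For $n>2$, $k\in\{1,\ldots,n-1\}$ and $l\in\{1,\ldots,n-2\}$, we have $$\partial^l_{n-1}\,\partial^k_n=0$$ as a homomorphism $C_n(X)\to C_{n-2}(X)$.
   Context: A magma $(X;* )$ (a set with a binary operation) is entropic if $(a*b)*(c*d)=(a*c)*(b*d)$ for all $a,b,c,d\in X$. For $n\ge 0$, $C_n(X)=\mathbb{Z}X^{2^n}$ is the free abelian group generated by the $2^n$-tuples $(x_1,\ldots,x_{2^n})$ of elements of $X$. The positions $1,2,\ldots,2^n$ are labelled by addresses: position $i$ has as its address the $i$-th element, in lexicographic order, of the list $T_n$ of all binary words of length $n$ (e.g. $T_3=\{000,001,010,011,100,101,110,111\}$), i.e. the $n$-digit binary expansion of $i-1$. For $0\le k\le n$, $S^k_{2^n}$ denotes the subgroup of the symmetric group $S_{2^n}$ (permutations of positions) consisting of the permutations that move only positions whose addresses contain exactly $k$ ones (all other positions are fixed). For a $2^n$-tuple $w$ and a permutation $\sigma\in S_{2^n}$, $\sigma w$ is the result of permuting the entries of $w$ by $\sigma$ (the entry in position $i$ is moved to position $\sigma(i)$), extended linearly to $C_n(X)$. For $k\in\{1,\ldots,n-1\}$ the homomorphism $\delta^k_n\colon C_n(X)\to C_n(X)$ is defined by $$\delta^k_n(w)=\sum_{\sigma\in S^k_{2^n}}\operatorname{sgn}(\sigma)\,\sigma w .$$ The homomorphism $\mu_n\colon C_n(X)\to C_{n-1}(X)$ is defined on tuples by $$\mu_n(x_1,x_2,x_3,x_4,\ldots,x_{2^n-1},x_{2^n})=(x_1*x_2,\,x_3*x_4,\ldots,x_{2^n-1}*x_{2^n}).$$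 Finally, $\partial^k_n=\mu_n\delta^k_n\colon C_n(X)\to C_{n-1}(X)$. *)

(* Defs.v *)
From HB Require Import structures.
From mathcomp Require Import all_boot all_order all_algebra all_fingroup.
From mathcomp Require Import boolp.
From mathcomp.multinomials Require Import freeg.

Set Implicit Arguments.
Unset Strict Implicit.
Unset Printing Implicit Defensive.

Import GRing.Theory.
Local Open Scope ring_scope.

Definition entropic (X : magmaType) : Prop :=
  forall a b c d : X, ((a * b) * (c * d) = (a * c) * (b * d))%g.

(* The alias [{classic _}] only provides the choice structure required by
   [freeg]; it is convertible to the type of tuples. *)
Definition chain (X : Type) (n : nat) := {freeg {classic (2 ^ n).-tuple X}}.

HB.instance Definition _ X n := GRing.Lmodule.on (chain X n).

Definition gen (X : Type) (n : nat) (w : (2 ^ n).-tuple X) : chain X n :=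
  << (w : {classic (2 ^ n).-tuple X}) >>.

(* Positions are counted from 0, so the address of [i] is its [n]-digit binary
   expansion, most significant digit first. *)
Definition address (n : nat) (i : 'I_(2 ^ n)) : n.-tuple bool :=
  [tuple odd (i %/ 2 ^ (n - j.+1)) | j < n].

Definition weight (n : nat) (i : 'I_(2 ^ n)) : nat :=
  count_mem true (address i).

Definition Sym_weight (n k : nat) : {group 'S_(2 ^ n)} :=
  Sym_group [set i | weight i == k].

(* The entry in position [i] is moved to position [s i]. *)
Definition permute (X : Type) (m : nat) (s : 'S_m) (w : m.-tuple X) :
  m.-tuple X := [tuple tnth w (s^-1%g i) | i < m].

Lemma child_subproof (n : nat) (i : 'I_(2 ^ n)) (b : bool) :
  (b + i.*2 < 2 ^ n.+1)%N.
Proof.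
rewrite expnS mul2n; apply: (@leq_trans i.+1.*2); last by rewrite leq_double.
by rewrite doubleS !ltnS; case: b.
Qed.

(* The position whose address is the address of [i] followed by [b]. *)
Definition child (n : nat) (i : 'I_(2 ^ n)) (b : bool) : 'I_(2 ^ n.+1) :=
  Ordinal (child_subproof i b).

Definition mul_pairs (X : magmaType) (n : nat) (w : (2 ^ n.+1).-tuple X) :
  (2 ^ n).-tuple X :=
  [tuple (tnth w (child i false) * tnth w (child i true))%g | i < 2 ^ n].

Definition delta (X : Type) (n k : nat) : chain X n -> chain X n :=
  fglift (fun w : {classic (2 ^ n).-tuple X} =>
    \sum_(s in Sym_weight n k) (-1) ^+ s *: gen (permute s w)).

(* Indexed by its target: this is the map from the [n.+1]-chains. *)
Definition mu (X : magmaType) (n : nat) : chain X n.+1 -> chain X n :=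
  fglift (fun w : {classic (2 ^ n.+1).-tuple X} => gen (mul_pairs w)).

HB.instance Definition _ X n k := GRing.isZmodMorphism.Build _ _
  (@delta X n k) (lift_is_additive _).

HB.instance Definition _ X n := GRing.isZmodMorphism.Build _ _
  (@mu X n) (lift_is_additive _).

(* Indexed by its target, like [mu]. *)
Definition boundary (X : magmaType) (n k : nat) :
  {additive chain X n.+1 -> chain X n} := @mu X n \o @delta X n.+1 k.

(* Main.v *)
Require Import Defs.
From mathcomp Require Import all_boot all_order all_algebra.
From mathcomp Require Import all_fingroup.
From mathcomp.multinomials Require Import freeg.

Set Implicit Arguments.
Unset Strict Implicit.
Unset Printing Implicit Defensive.

Import GRing.Theory.
Local Open Scope ring_scope.

(** On a generator [w], the composite of the two boundaries is the double
    alternating sum over [s] and [t] of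
    [mul_pairs (permute t (mul_pairs (permute s w)))], and the inner sum over
    [s] already vanishes for each [t].

    The entry of that tuple at a position [u] is [(a * b) * (c * d)], where
    [a, b] come from the children of a position [p], [c, d] from the children
    of a position [q], and [t] moves [p] and [q] to the two children of [u].
    Entropicity makes this product blind to exchanging [b] and [c]
    ([entropic_tperm]). Since [t] preserves weights, choosing [u] of weight
    [k - 1] gives [p] weight [k - 1] and [q] weight [k], so that [b] and [c]
    both sit at positions of weight [k]. Their transposition therefore lies in
    the group over which [s] ranges; composing with it pairs even permutations
    with odd ones having the same term, and everything cancels
    ([alternating_sum_eq0]). Such a [u] exists because its address has
    [n >= k - 1] digits. *)

Lemma weight_sum (n : nat) (i : 'I_(2 ^ n)) :
  weight i = (\sum_(j < n) odd (i %/ 2 ^ (n - j.+1)))%N.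
Proof.
rewrite /weight -sum1_count big_mkcond big_tuple /=; apply: eq_bigr => j _.
by rewrite tnth_mktuple; case: odd.
Qed.

Lemma weight_child (n : nat) (i : 'I_(2 ^ n)) (b : bool) :
  weight (child i b) = (weight i + b)%N.
Proof.
rewrite !weight_sum big_ord_recr /= subnn expn0 divn1 oddD odd_double addbF.
congr (_ + _)%N; last by case: b.
apply: eq_bigr => j _ /=; rewrite subSS -(subnSK (ltn_ord j)) expnS divnMA.
by rewrite divn2 halfD odd_double andbF add0n doubleK; case: b.
Qed.

Lemma child_inj (n : nat) (i j : 'I_(2 ^ n)) (a b : bool) :
  (child i a == child j b) = (i == j) && (a == b).
Proof.
apply/eqP/andP => [/(congr1 val) /= eq_ij|[/eqP-> /eqP->] //].
have eq_ab : a = b.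
  by have := congr1 odd eq_ij; rewrite !oddD !odd_double !addbF !oddb.
by move: eq_ij; rewrite eq_ab => /addnI /double_inj /val_inj ->.
Qed.

Lemma exists_weight (n m : nat) :
  (m <= n)%N -> exists u : 'I_(2 ^ n), weight u = m.
Proof.
elim: n m => [|n IHn] m.
  by rewrite leqn0 => /eqP->; exists ord0; rewrite weight_sum big_ord0.
case: m => [|m] le_mn.
  by have [u wu] := IHn 0%N isT; exists (child u false); rewrite weight_child wu.
by have [u wu] := IHn m le_mn; exists (child u true); rewrite weight_child wu addn1.
Qed.

(** A permutation supported on one weight class maps that class to itself and
    fixes everything else. *)
Lemma weight_Sym (n l : nat) (s : 'S_(2 ^ n)) (i : 'I_(2 ^ n)) :
  s \in Sym_weight n l -> weight (s i) = weight i.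
Proof.
rewrite inE => s_on; have := perm_closed i s_on; rewrite !inE.
case: (eqVneq (weight i) l) => [-> /eqP //|neq_il _].
by rewrite (out_perm s_on) // inE.
Qed.

Lemma permuteM (X : Type) (m : nat) (s t : 'S_m) (w : m.-tuple X) :
  permute (s * t)%g w = permute t (permute s w).
Proof. by apply: eq_from_tnth => i; rewrite !tnth_mktuple invMg permM. Qed.

(** After both multiplications, the children of [p] and [q] contribute only to
    the entry at [u]; there, [tperm] exchanges the two inner factors of a
    product of products, which is entropicity. *)
Lemma entropic_tperm (X : magmaType) (entropicX : entropic X) (n : nat)
    (v : (2 ^ n.+2).-tuple X) (s : 'S_(2 ^ n.+1)) (u : 'I_(2 ^ n)) :
  let p := (s^-1)%g (child u false) in
  let q := (s^-1)%g (child u true) in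
  let t := tperm (child p true) (child q false) in
  mul_pairs (permute s (mul_pairs (permute t v))) =
  mul_pairs (permute s (mul_pairs v)).
Proof.
move=> p q t; apply: eq_from_tnth => i; rewrite !tnth_mktuple tpermV.
have neq_pq : (p == q) = false by rewrite (inj_eq perm_inj) child_inj andbF.
have [<-|neq_ui] := eqVneq u i.
  rewrite -/p -/q tpermL tpermR entropicX.
  by rewrite !tpermD // child_inj ?[q == p]eq_sym ?neq_pq ?andbF.
by rewrite !tpermD // child_inj (inj_eq perm_inj) child_inj (negbTE neq_ui).
Qed.

(** Right translation by [t] is a sign-reversing bijection between the even and
    the odd elements of [G]. Matching the two halves, instead of deducing that
    the sum equals its opposite, avoids any torsion-freeness of [V]. *)
Lemma alternating_sum_eq0 (V : lmodType int) (m : nat) (G : {group 'S_m})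
    (t : 'S_m) (F : 'S_m -> V) :
  t \in G -> odd_perm t -> (forall s, F (s * t)%g = F s) ->
  \sum_(s in G) (-1) ^+ s *: F s = 0.
Proof.
move=> tG odd_t F_inv; rewrite (bigID (@odd_perm _)) /= addrC.
rewrite (reindex_inj (mulIg t)) /= -[X in X + _]opprK -sumrN.
apply/eqP; rewrite addrC subr_eq0; apply/eqP; apply: eq_big => s.
  by rewrite groupMr // odd_permM odd_t addbT negbK.
by move=> /andP[_ s1]; rewrite F_inv odd_permM odd_t s1 scale1r scaleN1r.
Qed.

Lemma additive_chain_eq0 (X : Type) (n : nat) (V : zmodType)
    (f : {additive chain X n -> V}) :
  (forall w, f (gen w) = 0) -> forall c, f c = 0.
Proof.
move=> f_gen c; rewrite -[c]freeg_sumE raddf_sum big1 // => w _.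
rewrite -[coeff w c]intz -freegU_mulz raddfMz.
by rewrite [X in X *~ _](f_gen w) mul0rz.
Qed.

Lemma boundary_gen (X : magmaType) (n k : nat) (w : (2 ^ n.+1).-tuple X) :
  boundary X n k (gen w) =
  \sum_(s in Sym_weight n.+1 k) (-1) ^+ s *: gen (mul_pairs (permute s w)).
Proof.
rewrite /boundary /= /delta liftU scale1r raddf_sum; apply: eq_bigr => s _.
by rewrite raddfZsign /= /mu liftU scale1r.
Qed.

Theorem theorem5p1 (X : magmaType) (entropicX : entropic X) (n k l : nat) :
  (2 < n.+2)%N -> (1 <= k <= n.+1)%N -> (1 <= l <= n)%N ->
  forall c : chain X n.+2, boundary X n l (boundary X n.+1 k c) = 0.
Proof.
move=> _ /andP[k_gt0 le_kn] _.
apply: (@additive_chain_eq0 _ _ _ (boundary X n l \o boundary X n.+1 k)) => w.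
rewrite [LHS](congr1 (boundary X n l) (boundary_gen k w)) raddf_sum.
under eq_bigr do rewrite raddfZsign boundary_gen scaler_sumr.
rewrite exchange_big big1 // => t t_l.
under eq_bigr do rewrite scalerA mulrC -scalerA.
rewrite -scaler_sumr.
(* Weight [k - 1], so that [child p true] and [child q false] below both have
   weight [k]. *)
have [u wu] : exists u : 'I_(2 ^ n), weight u = k.-1.
  by apply: exists_weight; rewrite -ltnS prednK.
pose p := (t^-1)%g (child u false); pose q := (t^-1)%g (child u true).
have tV_l : (t^-1)%g \in Sym_weight n.+1 l by rewrite groupV.
rewrite (@alternating_sum_eq0 _ _ _ (tperm (child p true) (child q false))) ?scaler0 //.
- rewrite inE; apply: (subset_trans (tperm_on _ _)).
  apply/subsetP => i; rewrite !inE => /orP[] /eqP->;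
    by rewrite weight_child (weight_Sym _ tV_l) weight_child wu addn0 addn1 prednK.
- by rewrite odd_tperm child_inj andbF.
by move=> s; rewrite permuteM entropic_tperm.
Qed.
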